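(* Let $q\ge 5$ be a prime power. For every integer $k$ with $2q\le k\le 3q-5$ there exists a minimal blocking set of size $k$ in $\mathrm{PG}(2,q)$ which has the $r_\infty$-property (with respect to some of its points) and which is not a blocking semioval.
   Context: A blocking set of $\mathrm{PG}(2,q)$ is a set of points meeting every line and containing no line; minimal if no proper subset is a blocking set. A line is tangent to a point set $\mathcal{K}$ if it meets $\mathcal{K}$ in exactly one point, secant if in more than one. A blocking set $\mathcal{B}$ has the $r_\infty$-property with respect to $P\in\mathcal{B}$ if exactly one line through $P$ is tangent to $\mathcal{B}$ and all other lines through $P$ are secants. A semioval is a point set $\mathcal{K}$ such that through each point of $\mathcal{K}$ there is exactly one tangent line to $\mathcal{K}$; a blocking semioval is a blocking set which is a semioval. *)

(* Defs.v *)
From HB Require Import structures.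
From mathcomp Require Import all_boot all_algebra.

Set Implicit Arguments.
Unset Strict Implicit.
Unset Printing Implicit Defensive.

HB.instance Definition _ (F : finFieldType) (vT : vectType F) :=
  Countable.copy {vspace vT} (can_type (@VectorInternalTheory.vs2mxK F vT)).
HB.instance Definition _ (F : finFieldType) (vT : vectType F) :
    isFinite {vspace vT} :=
  CanIsFinite (@VectorInternalTheory.vs2mxK F vT).

(* PG(2, #|F|): the points and the lines are the subspaces of F^3 of dimension
   1 and 2, and incidence is inclusion. *)
Definition point (F : finFieldType) : Type :=
  {U : {vspace 'rV[F]_3} | \dim U == 1}.
Definition line (F : finFieldType) : Type :=
  {U : {vspace 'rV[F]_3} | \dim U == 2}.
HB.instance Definition _ (F : finFieldType) := SubFinite.on (point F).
HB.instance Definition _ (F : finFieldType) := SubFinite.on (line F).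

Section BlockingSets.
Variable F : finFieldType.
Implicit Types (P : point F) (l : line F) (K B : {set point F}).

Definition incident P l : bool := (val P <= val l)%VS.

Definition points_on l : {set point F} := [set P | incident P l].

Definition blocking_set B : bool :=
  [forall l, B :&: points_on l != set0] &&
  [forall l, ~~ (points_on l \subset B)].

Definition minimal_blocking_set B : bool := minset blocking_set B.

Definition tangent K l : bool := #|K :&: points_on l| == 1.

Definition secant K l : bool := 1 < #|K :&: points_on l|.

Definition r_infty B P : bool :=
  [&& blocking_set B, P \in B,
      #|[set l | incident P l && tangent B l]| == 1
    & [forall l, incident P l && ~~ tangent B l ==> secant B l]].

Definition semioval K : bool :=
  [forall P in K, #|[set l | incident P l && tangent K l]| == 1].

Definition blocking_semioval B : bool := blocking_set B && semioval B.

End BlockingSets.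

(* Main.v *)
(** In affine coordinates over F, with C a subset of F^* containing 1 and -1, and
    X = F^* \ C, let B consist of the points (1 : m : 0) with m <> 0, the affine
    points (x, 0) and (0, x) with x in X, and the points (c, c) with c in C.
    This is the vertexless triangle in which the points indexed by C of two
    sides are replaced by points of a diagonal, so |B| = 3q - 3 - |C|.  Each
    point of B lies on a tangent: x = const or y = const for the affine points,
    y = mx for (1 : m : 0) with m <> 1, and y = x + 1 for (1 : 1 : 0), because
    neither 1 nor -1 is in X.  A line of nonzero slope contains a point of B at
    infinity, hence (x, 0) has only one tangent, while (c, c) has two. *)
Require Import Defs.
From HB Require Import structures.
From mathcomp Require Import all_boot all_algebra.
From mathcomp Require Import ring zify.

Set Implicit Arguments.
Unset Strict Implicit.
Unset Printing Implicit Defensive.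

Import GRing.Theory.
(** Supplies the index set [C] of any admissible size: [n - #|A|] elements of [D :\: A] are adjoined
    to [A]. *)
Lemma set_between_card (T : finType) (A D : {set T}) (n : nat) :
    A \subset D -> #|A| <= n <= #|D| ->
  exists C : {set T}, [/\ A \subset C, C \subset D & #|C| = n].
Proof.
move=> AD /andP[An nD].
have [s [uniq_s size_s s_sub]] : exists s,
    [/\ uniq s, size s = n - #|A| & {subset s <= D :\: A}].
  by apply/card_geqP; rewrite cardsDS // leq_sub2r.
have disj : A :&: [set x in s] = set0.
  apply/eqP; rewrite -subset0; apply/subsetP=> x /setIP[Ax].
  by rewrite inE => /s_sub; rewrite in_setD Ax.
exists (A :|: [set x in s]); split; first exact: subsetUl.
  rewrite subUset AD; apply/subsetP=> x; rewrite inE => /s_sub.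
  by rewrite in_setD => /andP[].
have card_s : #|[set x in s]| = size s by rewrite cardsE; apply/card_uniqP.
by rewrite cardsU disj cards0 subn0 card_s size_s subnKC.
Qed.

(** * Incidence, tangents and a criterion for minimality *)

Section ProjectivePlane.
Local Open Scope ring_scope.
Variable F : finFieldType.
Implicit Types (P Q : point F) (l : line F) (B : {set point F}).

Definition mkpoint (U : {vspace 'rV[F]_3}) (dimU : \dim U == 1%N) : point F :=
  exist _ U dimU.

Definition mkline (U : {vspace 'rV[F]_3}) (dimU : \dim U == 2%N) : line F :=
  exist _ U dimU.

(** Two planes of a 3-dimensional space share a nonzero vector, as 2 + 2 > 3. This serves both for a
    common point of two lines and, dually, for a normal vector in [line_orthov]. *)
Lemma capv_planes (U V : {vspace 'rV[F]_3}) :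
  \dim U = 2 -> \dim V = 2 -> vpick (U :&: V)%VS != 0.
Proof.
move=> dimU dimV; rewrite vpick0 -dimv_eq0 -lt0n.
have := dimv_sum_cap U V; have := dimvS (subvf (U + V)%VS).
by rewrite dimvf /dim /= dimU dimV; lia.
Qed.

Lemma lines_meet l l' : exists P, incident P l && incident P l'.
Proof.
have nz := capv_planes (eqP (valP l)) (eqP (valP l')).
have dim1 : \dim <[vpick (val l :&: val l')%VS]> == 1%N by rewrite dim_vline nz.
by exists (mkpoint dim1); rewrite /incident -subv_cap; exact: memv_pick.
Qed.

Lemma tangentI B P l :
    P \in B -> incident P l ->
    (forall Q, Q \in B -> incident Q l -> Q = P) ->
  tangent B l.
Proof.
move=> BP lP uniqP; apply/cards1P; exists P; apply/setP=> Q; rewrite !inE.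
by apply/andP/eqP=> [[BQ lQ]|->]; [exact: uniqP | split].
Qed.

Lemma tangent_uniq B P Q l :
    tangent B l -> P \in B -> Q \in B -> incident P l -> incident Q l -> P = Q.
Proof.
move=> /cards1P[R BlR] BP BQ lP lQ.
have eqR S : S \in B -> incident S l -> S = R.
  by move=> BS lS; apply/set1P; rewrite -BlR !inE BS.
by rewrite (eqR P) // (eqR Q).
Qed.

(** A blocking subset of [B] must meet the tangent at each [P] in [B], and can do so only in [P];
    hence it is all of [B]. If [B] contained a line [l], the tangent at a point [P] of [B] off [l]
    would meet [l] in a second point of [B]. *)
Lemma minimal_blocking_setI B :
    (forall l, exists2 P, P \in B & incident P l) ->
    (forall l, exists2 P, P \in B & ~~ incident P l) ->
    (forall P, P \in B -> exists2 l, incident P l & tangent B l) ->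
  minimal_blocking_set B.
Proof.
move=> meetB offB tanB; apply/minsetP; split.
  apply/andP; split; apply/forallP=> l.
    by have [P BP lP] := meetB l; apply/set0Pn; exists P; rewrite !inE BP.
  apply/negP=> /subsetP lB.
  have [P BP lP] := offB l; have [t tP tanP] := tanB P BP.
  have [Q /andP[lQ tQ]] := lines_meet l t.
  have BQ : Q \in B by apply: lB; rewrite inE.
  by rewrite (tangent_uniq tanP BP BQ tP tQ) lQ in lP.
move=> A /andP[/forallP meetA _] AB; apply/eqP; rewrite eqEsubset AB /=.
apply/subsetP=> P BP; have [t tP tanP] := tanB P BP.
have /set0Pn[Q] := meetA t; rewrite !inE => /andP[AQ tQ].
by rewrite (tangent_uniq tanP BP (subsetP AB _ AQ) tP tQ).
Qed.

(** * Homogeneous coordinates and normal vectors of lines *)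

Definition vec3 (a b c : F) : 'rV[F]_3 := \row_i [:: a; b; c]`_i.

Lemma vec3_eta (v : 'rV[F]_3) : v = vec3 (v 0 0) (v 0 1) (v 0 2%:R).
Proof.
apply/rowP=> i; rewrite mxE; case: i => [[|[|[|//]]] ?] /=;
  by congr (v _ _); apply: val_inj.
Qed.

Lemma vec3_eq0 a b c : (vec3 a b c == 0) = [&& a == 0, b == 0 & c == 0].
Proof.
apply/eqP/and3P=> [/rowP v0 | [/eqP-> /eqP-> /eqP->]].
  by split; apply/eqP; [have := v0 0 | have := v0 1 | have := v0 2%:R];
     rewrite !mxE.
by apply/rowP=> -[[|[|[|//]]] ?]; rewrite !mxE.
Qed.

Lemma scale_vec3 k a b c : k *: vec3 a b c = vec3 (k * a) (k * b) (k * c).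
Proof. by apply/rowP=> -[[|[|[|//]]] ?]; rewrite !mxE. Qed.

Lemma vec3_inj a b c x y z :
  vec3 a b c = vec3 x y z -> [/\ a = x, b = y & c = z].
Proof.
by move=> /rowP e; split; [have := e 0 | have := e 1 | have := e 2%:R];
   rewrite !mxE.
Qed.

(** The codomain [F^o] is [F] as a vector space over itself, so that [linfun] and [lker] apply. *)
Definition dot (n v : 'rV[F]_3) : F^o := \sum_i n 0 i * v 0 i.

Fact dot_is_linear n : linear (dot n).
Proof.
move=> k u v; rewrite /dot scaler_sumr -big_split /=; apply: eq_bigr => i _.
by rewrite !mxE mulrDr mulrCA.
Qed.
HB.instance Definition _ n :=
  GRing.isLinear.Build F 'rV[F]_3 F^o _ (dot n) (dot_is_linear n).

Lemma dotC n v : dot n v = dot v n.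
Proof. by apply: eq_bigr => i _; rewrite mulrC. Qed.

Lemma dot_vec3 a b c x y z :
  dot (vec3 a b c) (vec3 x y z) = a * x + b * y + c * z.
Proof. by rewrite /dot !big_ord_recr big_ord0 !mxE /= add0r. Qed.

Definition orthov (n : 'rV[F]_3) : {vspace 'rV[F]_3} := lker (linfun (dot n)).

Lemma mem_orthov n v : (v \in orthov n) = (dot n v == 0).
Proof. by rewrite memv_ker lfunE. Qed.

Lemma orthov_scale k n : k != 0 -> orthov (k *: n) = orthov n.
Proof.
move=> k0; apply/vspaceP=> v; rewrite !mem_orthov !(dotC _ v) linearZ /=.
by rewrite mulf_eq0 (negPf k0).
Qed.

Lemma dim_orthov n : n != 0 -> \dim (orthov n) == 2%N.
Proof.
move=> n0; have := limg_ker_dim (linfun (dot n)) fullv.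
rewrite capfv dimvf -/(orthov n) /dim /=.
(* A nonzero form is onto [F], so its kernel has dimension 3 - 1; a preimage of [x] is found on a
   coordinate axis where [n] does not vanish. *)
suff -> : (linfun (dot n) @: fullv)%VS = fullv.
  by rewrite dimvf /dim /= addn1 => -[->].
have [i ni] : exists i, n 0 i != 0 by apply/rV0Pn.
apply/vspaceP=> x; rewrite memvf.
apply/memv_imgP; exists ((x / n 0 i) *: delta_mx 0 i); first exact: memvf.
rewrite lfunE /= linearZ /= /dot (bigD1 i) //= big1 => [|j ji].
  by rewrite !mxE !eqxx mulr1 addr0 /GRing.scale /= divfK.
by rewrite !mxE (negPf ji) andbF mulr0.
Qed.

(** A nonzero [n] orthogonal to both basis vectors of [l] gives an inclusion of [l] in [orthov n],
    and the dimensions agree. *)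
Lemma line_orthov l : exists2 n, n != 0 & val l = orthov n.
Proof.
have diml : \dim (val l) = 2 := eqP (valP l).
pose e i := (vbasis (val l))`_i.
have e0 i : (i < 2)%N -> e i != 0.
  move=> i2; apply: (free_not0 (basis_free (vbasisP (val l)))).
  by apply: mem_nth; rewrite size_tuple diml.
have dime i : (i < 2)%N -> \dim (orthov (e i)) = 2.
  by move=> i2; apply/eqP/dim_orthov/e0.
exists (vpick (orthov (e 0%N) :&: orthov (e 1%N))).
  by apply: capv_planes; apply: dime.
set n := vpick _; have nn : n != 0 by apply: capv_planes; apply: dime.
apply/eqP; rewrite eqEdim diml (eqP (dim_orthov nn)) andbT.
rewrite -(span_basis (vbasisP (val l))).
apply/span_subvP=> v /(nthP 0)[i].
rewrite [X in (_ < X)%N](size_tuple _) [X in (_ < X)%N]diml => i2 <-.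
rewrite mem_orthov dotC -mem_orthov.
have := memv_pick (orthov (e 0%N) :&: orthov (e 1%N)); rewrite memv_cap.
by case: i i2 => [|[|//]] _ /andP[].
Qed.

(** * Affine points, points at infinity and equations of lines *)

Fact pt_aff_dim x y : \dim <[vec3 x y 1]> == 1%N.
Proof. by rewrite dim_vline vec3_eq0 oner_eq0 !andbF. Qed.
Definition pt_aff (p : F * F) : point F := mkpoint (pt_aff_dim p.1 p.2).

Fact pt_inf_dim m : \dim <[vec3 1 m 0]> == 1%N.
Proof. by rewrite dim_vline vec3_eq0 oner_eq0. Qed.
Definition pt_inf m : point F := mkpoint (pt_inf_dim m).

Lemma pt_aff_inj : injective pt_aff.
Proof.
move=> [x y] [x' y'] /(congr1 val) /= e; have := memv_line (vec3 x y 1).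
rewrite e => /vlineP[k]; rewrite scale_vec3 => /vec3_inj[-> ->].
by rewrite mulr1 => <-; rewrite !mul1r.
Qed.

Lemma pt_inf_inj : injective pt_inf.
Proof.
move=> m m' /(congr1 val) /= e; have := memv_line (vec3 1 m 0).
rewrite e => /vlineP[k]; rewrite scale_vec3 => /vec3_inj[e1 -> _].
by rewrite mulr1 in e1; rewrite -e1 mul1r.
Qed.

Lemma pt_aff_neq_inf p m : pt_aff p <> pt_inf m.
Proof.
move=> /(congr1 val) /= e; have := memv_line (vec3 p.1 p.2 1).
rewrite e => /vlineP[k]; rewrite scale_vec3 => /vec3_inj[_ _ /eqP].
by rewrite mulr0 oner_eq0.
Qed.

(** The normal vector encodes the equation [y = m x + c] in the chart where the third coordinate is
    1. *)
Fact line_slope_dim m c : \dim (orthov (vec3 m (-1) c)) == 2%N.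
Proof. by rewrite dim_orthov // vec3_eq0 oppr_eq0 oner_eq0 andbF. Qed.
Definition line_slope m c : line F := mkline (line_slope_dim m c).

Fact line_vert_dim u : \dim (orthov (vec3 1 0 (- u))) == 2%N.
Proof. by rewrite dim_orthov // vec3_eq0 oner_eq0. Qed.
Definition line_vert u : line F := mkline (line_vert_dim u).

Fact line_inf_dim : \dim (orthov (vec3 0 0 1)) == 2%N.
Proof. by rewrite dim_orthov // vec3_eq0 oner_eq0 !andbF. Qed.
Definition line_inf : line F := mkline line_inf_dim.

Variant line_spec : line F -> Prop :=
  | LineSlope m c : line_spec (line_slope m c)
  | LineVert u : line_spec (line_vert u)
  | LineInf : line_spec line_inf.

(** A normal vector matters only up to a scalar: its middle entry can be made -1 or, if that entry
    vanishes, its first entry 1, or else its third. *)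
Lemma lineP l : line_spec l.
Proof.
have [n] := line_orthov l; rewrite (vec3_eta n).
move: (n 0 0) (n 0 1) (n 0 2%:R) => a b c; rewrite vec3_eq0 => nz el.
have [b0 | bn0] := eqVneq b 0; last first.
  suff -> : l = line_slope (- a / b) (- c / b) by exact: LineSlope.
  apply: val_inj; rewrite el /=.
  rewrite -[RHS](orthov_scale _ (_ : - b != 0)) ?oppr_eq0 //.
  by congr orthov; rewrite scale_vec3; congr vec3; field.
have [a0 | an0] := eqVneq a 0; last first.
  suff -> : l = line_vert (- c / a) by exact: LineVert.
  apply: val_inj; rewrite el /= -[RHS](orthov_scale _ an0).
  by congr orthov; rewrite scale_vec3 b0; congr vec3; field.
suff -> : l = line_inf by exact: LineInf.
have cn0 : c != 0 by move: nz; rewrite a0 b0 !eqxx.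
apply: val_inj; rewrite el /= -[RHS](orthov_scale _ cn0).
by rewrite scale_vec3 a0 b0 !mulr0 mulr1.
Qed.

Lemma aff_slope p m c :
  incident (pt_aff p) (line_slope m c) = (p.2 == m * p.1 + c).
Proof.
rewrite /incident /= -memvE mem_orthov dot_vec3 -[RHS]subr_eq0 -oppr_eq0.
by congr (_ == 0); ring.
Qed.

Lemma aff_vert p u : incident (pt_aff p) (line_vert u) = (p.1 == u).
Proof.
rewrite /incident /= -memvE mem_orthov dot_vec3 -[RHS]subr_eq0.
by congr (_ == 0); ring.
Qed.

Lemma aff_inf p : incident (pt_aff p) line_inf = false.
Proof.
by rewrite /incident /= -memvE mem_orthov dot_vec3 !mul0r !add0r mulr1 oner_eq0.
Qed.

Lemma inf_slope m' m c : incident (pt_inf m') (line_slope m c) = (m' == m).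
Proof.
rewrite /incident /= -memvE mem_orthov dot_vec3 -[RHS]subr_eq0 -oppr_eq0.
by congr (_ == 0); ring.
Qed.

Lemma inf_vert m u : incident (pt_inf m) (line_vert u) = false.
Proof.
rewrite /incident /= -memvE mem_orthov dot_vec3 mul0r mulr0 !addr0 mulr1.
exact: oner_eq0.
Qed.

Lemma inf_inf m : incident (pt_inf m) line_inf.
Proof. by rewrite /incident /= -memvE mem_orthov dot_vec3; apply/eqP; ring. Qed.

Definition incE :=
  (aff_slope, aff_vert, aff_inf, inf_slope, inf_vert, inf_inf).

End ProjectivePlane.

(** * The trimmed triangle: tangents, minimality and size *)

Section TrimmedTriangle.
Local Open Scope ring_scope.
Variables (F : finFieldType) (C : {set F}).
Hypotheses (C0 : 0 \notin C) (C1 : 1 \in C) (CN1 : -1 \in C).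

Let X : {set F} := ~: (0 |: C).
Hypothesis X2 : (1 < #|X|)%N.

Let S : {set F * F} :=
  setX X [set 0] :|: setX [set 0] X :|: [set (c, c) | c in C].

Definition trimmed_triangle : {set point F} :=
  [set pt_inf m | m in [set~ 0]] :|: [set pt_aff p | p in S].
Local Notation B := trimmed_triangle.

Let inX x : (x \in X) = (x != 0) && (x \notin C).
Proof. by rewrite !inE negb_or. Qed.

Let inS x y : ((x, y) \in S) =
  [|| (x \in X) && (y == 0), (x == 0) && (y \in X) | (x \in C) && (y == x)].
Proof.
rewrite in_setU in_setU !in_setX !in_set1 -orbA; congr [|| _, _ | _].
apply/imsetP/andP=> [[c Cc [-> ->]] | [Cx /eqP->]]; last by exists x.
by rewrite Cc eqxx.
Qed.

Let inf_inB m : (pt_inf m \in B) = (m != 0).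
Proof.
rewrite inE (mem_imset _ _ (@pt_inf_inj F)) !inE orbC.
by case: imsetP => // -[p _ /esym/pt_aff_neq_inf].
Qed.

Let aff_inB x y : (pt_aff (x, y) \in B) = ((x, y) \in S).
Proof.
rewrite inE (mem_imset _ _ (@pt_aff_inj F)).
by case: imsetP => // -[m _ /pt_aff_neq_inf].
Qed.

Variant trimmed_triangle_spec : point F -> Prop :=
  | TriangleInf m of m != 0 : trimmed_triangle_spec (pt_inf m)
  | TriangleHor x of x \in X : trimmed_triangle_spec (pt_aff (x, 0))
  | TriangleVert y of y \in X : trimmed_triangle_spec (pt_aff (0, y))
  | TriangleDiag c of c \in C : trimmed_triangle_spec (pt_aff (c, c)).

Let inB P : P \in B -> trimmed_triangle_spec P.
Proof.
rewrite inE => /orP[/imsetP[m m0 ->] | /imsetP[[x y] + ->]].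
  by apply: TriangleInf; move: m0; rewrite !inE.
rewrite inS => /or3P[] /andP[].
- by move=> Xx /eqP->; apply: TriangleHor.
- by move=> /eqP->; apply: TriangleVert.
- by move=> Cx /eqP->; apply: TriangleDiag.
Qed.

Let horB x : x \in X -> pt_aff (x, 0) \in B.
Proof. by move=> Xx; rewrite aff_inB inS Xx eqxx. Qed.

Let vertB y : y \in X -> pt_aff (0, y) \in B.
Proof. by move=> Xy; rewrite aff_inB inS Xy eqxx orbT. Qed.

Let diagB c : c \in C -> pt_aff (c, c) \in B.
Proof. by move=> Cc; rewrite aff_inB inS Cc eqxx !orbT. Qed.

Let X_neq0 x : x \in X -> x != 0.
Proof. by rewrite inX => /andP[]. Qed.

Let C_neq0 c : c \in C -> c != 0.
Proof. by apply: contraTneq => ->. Qed.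

Let XC_neq x c : x \in X -> c \in C -> x != c.
Proof. by rewrite inX => /andP[_ xC] Cc; apply: contraNneq xC => ->. Qed.

(** A second point on each axis: it keeps the axis [y = 0] from being tangent, and keeps [B] from
    having its points on [x = 0] all on one other line. *)
Let other x : x \in X -> exists2 y, y \in X & y != x.
Proof.
move=> Xx; have [|y] := set0Pn (X :\ x) _.
  by rewrite -card_gt0; move: X2; rewrite (cardsD1 x) Xx.
by rewrite in_setD1 => /andP[yx Xy]; exists y.
Qed.

Let X_nonempty : exists x, x \in X.
Proof. by apply/card_gt0P; apply: ltnW. Qed.

(** A line [y = m x] with [m] nonzero meets the axes only in the origin, which is not in [B], and
    for [m != 1] the same holds for the diagonal. *)
Let tangent_inf m : m != 0 -> m != 1 -> tangent B (line_slope m 0).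
Proof.
move=> m0 m1; apply: (@tangentI _ _ (pt_inf m)); rewrite ?inf_inB ?incE //.
move=> Q /inB[m' _|x Xx|y Xy|c Cc]; rewrite incE /= ?mulr0 ?addr0.
- by move/eqP->.
- by rewrite eq_sym mulf_eq0 (negPf m0) (negPf (X_neq0 Xx)).
- by rewrite (negPf (X_neq0 Xy)).
- rewrite -{1}[c]mul1r (inj_eq (mulIf (C_neq0 Cc))).
  by rewrite eq_sym (negPf m1).
Qed.

(** The line [y = x + 1] is parallel to the diagonal and cuts the axes in (-1, 0) and (0, 1), which
    are absent because -1 and 1 are in [C]. *)
Let tangent_inf1 : tangent B (line_slope 1 1).
Proof.
apply: (@tangentI _ _ (pt_inf 1)); rewrite ?inf_inB ?incE ?oner_eq0 //.
move=> Q /inB[m' _|x Xx|y Xy|c Cc]; rewrite incE /= ?mulr0 ?mul1r ?add0r.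
- by move/eqP->.
- by rewrite eq_sym addr_eq0 (negPf (XC_neq Xx CN1)).
- by rewrite (negPf (XC_neq Xy C1)).
- by rewrite -subr_eq0 opprD addNKr oppr_eq0 oner_eq0.
Qed.

(** Parallels to the axes have no point of [B] at infinity: (0 : 1 : 0) is not of the form
    [pt_inf m], and [m = 0] is excluded. *)
Let tangent_vert x : x \in X -> tangent B (line_vert x).
Proof.
move=> Xx; apply: (@tangentI _ _ (pt_aff (x, 0))); rewrite ?horB ?incE //.
move=> Q /inB[m' _|x' _|y _|c Cc]; rewrite incE //=.
- by move/eqP->.
- by rewrite eq_sym (negPf (X_neq0 Xx)).
- by rewrite eq_sym (negPf (XC_neq Xx Cc)).
Qed.

Let tangent_hor y : y \in X -> tangent B (line_slope 0 y).
Proof.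
move=> Xy; apply: (@tangentI _ _ (pt_aff (0, y))).
- exact: vertB.
- by rewrite incE mul0r add0r.
move=> Q /inB[m' m0|x _|y' _|c Cc]; rewrite incE /= ?mul0r ?add0r.
- by rewrite (negPf m0).
- by rewrite eq_sym (negPf (X_neq0 Xy)).
- by move/eqP->.
- by rewrite eq_sym (negPf (XC_neq Xy Cc)).
Qed.

Let tangent_vertC c : c \in C -> tangent B (line_vert c).
Proof.
move=> Cc; apply: (@tangentI _ _ (pt_aff (c, c))); rewrite ?diagB ?incE //.
move=> Q /inB[m' _|x Xx|y _|c' _]; rewrite incE //=.
- by rewrite (negPf (XC_neq Xx Cc)).
- by rewrite eq_sym (negPf (C_neq0 Cc)).
- by move/eqP->.
Qed.

Let tangent_horC c : c \in C -> tangent B (line_slope 0 c).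
Proof.
move=> Cc; apply: (@tangentI _ _ (pt_aff (c, c))).
- exact: diagB.
- by rewrite incE mul0r add0r.
move=> Q /inB[m' m0|x _|y Xy|c' _]; rewrite incE /= ?mul0r ?add0r.
- by rewrite (negPf m0).
- by rewrite eq_sym (negPf (C_neq0 Cc)).
- by rewrite (negPf (XC_neq Xy Cc)).
- by move/eqP->.
Qed.

Lemma minimal_trimmed_triangle : minimal_blocking_set B.
Proof.
have [x Xx] := X_nonempty; have [y Xy yx] := other Xx.
apply: minimal_blocking_setI.
(* Lines with nonzero slope and the line at infinity are blocked at infinity. On a parallel to an
   axis, the nonzero constant is in [C] or in [X], which selects a diagonal or an axis point. *)
- move=> l; case: (lineP l) => [m c|u|]; last first.
  + by exists (pt_inf 1); rewrite ?inf_inB ?oner_eq0 ?incE.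
  + have [->|u0] := eqVneq u 0.
      by exists (pt_aff (0, x)); rewrite ?vertB ?incE.
    have [Cu|uC] := boolP (u \in C).
      by exists (pt_aff (u, u)); rewrite ?diagB ?incE.
    by exists (pt_aff (u, 0)); rewrite ?horB ?incE ?inX ?u0.
  have [->|m0] := eqVneq m 0; last first.
    by exists (pt_inf m); rewrite ?inf_inB ?incE.
  have [->|c0] := eqVneq c 0.
    by exists (pt_aff (x, 0)); rewrite ?horB ?incE ?mul0r ?addr0.
  have [Cc|cC] := boolP (c \in C).
    by exists (pt_aff (c, c)); rewrite ?diagB ?incE ?mul0r ?add0r.
  by exists (pt_aff (0, c)); rewrite ?vertB ?incE ?inX ?c0 ?mul0r ?add0r.
- move=> l; case: (lineP l) => [m c|u|].
  (* A line of slope [m] meets [x = 0] only in [(0, c)], so it misses one of [(0, x)] and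
     [(0, y)]. *)
  + have [c0|cx] := eqVneq c x.
      exists (pt_aff (0, y)); first exact: vertB.
      by rewrite incE /= mulr0 add0r c0.
    exists (pt_aff (0, x)); first exact: vertB.
    by rewrite incE /= mulr0 add0r eq_sym.
  + by exists (pt_inf 1); rewrite ?inf_inB ?oner_eq0 ?incE.
  + by exists (pt_aff (0, x)); rewrite ?vertB ?incE.
- move=> P /inB[m m0|z Xz|z Xz|c Cc].
  + have [->|m1] := eqVneq m 1.
      by exists (line_slope 1 1); rewrite ?incE ?tangent_inf1.
    by exists (line_slope m 0); rewrite ?incE ?tangent_inf.
  + by exists (line_vert z); rewrite ?incE ?tangent_vert.
  + by exists (line_slope 0 z); rewrite ?incE ?tangent_hor ?mul0r ?add0r.
  + by exists (line_vert c); rewrite ?incE ?tangent_vertC.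
Qed.

Lemma r_infty_trimmed_triangle : exists P, r_infty B P.
Proof.
have [x Xx] := X_nonempty; have [y Xy yx] := other Xx.
have [blockB _] := minsetP minimal_trimmed_triangle.
exists (pt_aff (x, 0)); apply/and4P; split=> //; first exact: horB.
  apply/cards1P; exists (line_vert x); apply/setP=> l; rewrite !inE.
  apply/andP/eqP=> [[]|->]; last by rewrite incE tangent_vert.
  case: (lineP l) => [m c xl tanl|u|]; rewrite ?incE //=; last by move/eqP->.
  have uniq_x Q : Q \in B -> incident Q (line_slope m c) -> Q = pt_aff (x, 0).
    by move=> BQ lQ; exact: (tangent_uniq tanl BQ (horB Xx) lQ xl).
  (* A non-vertical line through [(x, 0)] has a second point of [B]: [pt_inf m] if [m] is nonzero,
     and [(y, 0)] if it is the axis. *)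
  have [m0|m0] := eqVneq m 0; last first.
    have /esym/pt_aff_neq_inf// : pt_inf m = pt_aff (x, 0).
    by apply: uniq_x; rewrite ?inf_inB ?incE.
  have /pt_aff_inj[/eqP] : pt_aff (y, 0) = pt_aff (x, 0).
    apply: uniq_x; first exact: horB.
    by move: xl; rewrite !incE m0 !mul0r.
  by rewrite (negPf yx).
apply/forallP=> l; apply/implyP=> /andP[xl tanl]; rewrite /secant ltn_neqAle.
rewrite eq_sym [_ == _](negPf tanl) card_gt0.
by apply/set0Pn; exists (pt_aff (x, 0)); rewrite in_setI horB // inE.
Qed.

Lemma trimmed_triangle_not_semioval : ~~ semioval B.
Proof.
apply/negP=> /forall_inP/(_ _ (diagB C1))/cards1P[l eql].
have vl : line_vert 1 = l.
  by apply/set1P; rewrite -eql !inE !incE eqxx tangent_vertC.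
have hl : line_slope 0 1 = l.
  by apply/set1P; rewrite -eql !inE !incE mul0r add0r eqxx tangent_horC.
(* The two tangents at (1, 1) differ: (1 : 0 : 0) lies on the horizontal one only. *)
by have := inf_slope (0 : F) 0 1; rewrite hl -vl inf_vert eqxx.
Qed.

(** With [q = #|F|], there are [q - 1] points at infinity, [q - 1 - #|C|] on each axis and [#|C|] on
    the diagonal, all distinct. *)
Lemma card_trimmed_triangle : #|B| = (3 * #|F| - 3 - #|C|)%N.
Proof.
have cardX : #|X| = (#|F| - #|C|.+1)%N by rewrite cardsCs setCK cardsU1 C0.
have cardD : #|[set (c, c) | c in C]| = #|C| by apply: card_imset => x y [].
have capB : [set pt_inf m | m in [set~ 0]] :&: [set pt_aff p | p in S] = set0.
  apply/eqP; rewrite -subset0; apply/subsetP=> P; rewrite inE.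
  by case/andP=> /imsetP[m _ ->] /imsetP[p _ /esym/pt_aff_neq_inf].
have capX : setX X [set 0] :&: setX [set 0] X = set0.
  apply/eqP; rewrite -subset0; apply/subsetP=> -[x y].
  by rewrite in_setI !in_setX !in_set1 => /andP[/andP[/X_neq0/negPf->]].
have capD :
    (setX X [set 0] :|: setX [set 0] X) :&: [set (c, c) | c in C] = set0.
  apply/eqP; rewrite -subset0; apply/subsetP=> -[x y].
  rewrite in_setI => /andP[xyX /imsetP[c Cc [xc yc]]]; move: xyX.
  by rewrite xc yc in_setU !in_setX !in_set1 (negPf (C_neq0 Cc)) andbF.
rewrite cardsU capB.
rewrite (card_imset _ (@pt_inf_inj F)) (card_imset _ (@pt_aff_inj F)).
rewrite cardsU capD cardD cardsU capX !cardsX !cards0 cards1 cardsC1.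
(* [X2] gives [#|C| < q], so that no truncated subtraction is cut off at 0. *)
by move: X2; rewrite cardX; move: #|F| #|C| => q n; lia.
Qed.

End TrimmedTriangle.

Theorem theorem3p10 (F : finFieldType) (q k : nat) (hF : #|F| = q)
    (hq : 5 <= q) (hk : 2 * q <= k <= 3 * q - 5) :
  exists B : {set point F},
    [/\ minimal_blocking_set B, #|B| = k,
        exists P : point F, r_infty B P
      & ~~ blocking_semioval B].
Proof.
have /andP[k_ge k_le] := hk.
pose P0 : {set F} := [set 1%R; (-1)%R].
(* Only a bound, since 1 and -1 coincide in characteristic 2. *)
have P0_le : #|P0| <= 2 by rewrite cards2; case: eqP.
(* The size of [C] is forced by [3 * q - 3 - #|C| = k]. The bound [k <= 3 * q - 5] makes it at least
   2, leaving room for 1 and -1; [2 * q <= k] makes it at most [q - 3], leaving two elements for the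
   complement [X]. *)
have [||C [P0C CD cardC]] :=
    @set_between_card _ P0 [set~ 0%R] (3 * q - 3 - k).
- apply/subsetP=> x; rewrite !inE => /orP[] /eqP->; first exact: oner_neq0.
  by rewrite oppr_eq0 oner_neq0.
- by rewrite cardsC1 hF; move: #|P0| P0_le => n; lia.
have C0 : 0%R \notin C.
  by apply/negP=> /(subsetP CD); rewrite in_setC in_set1 eqxx.
have C1 : 1%R \in C by apply: (subsetP P0C); rewrite !inE eqxx.
have CN1 : (-1)%R \in C by apply: (subsetP P0C); rewrite !inE eqxx orbT.
have X2 : 1 < #|~: (0%R |: C)|.
  by rewrite cardsCs setCK cardsU1 C0 cardC hF; lia.
exists (trimmed_triangle C); split.
- exact: minimal_trimmed_triangle.
- by rewrite card_trimmed_triangle // cardC hF; lia.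
- exact: r_infty_trimmed_triangle.
- by rewrite negb_and trimmed_triangle_not_semioval ?orbT.
Qed.
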